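(* Let $n, d \ge 1$ be integers, let $\langle L, R\rangle$ be an orthogonal vectors instance consisting of two sets $L = \{l_1,\dots,l_n\}$ and $R=\{r_1,\dots,r_n\}$ of $d$-dimensional bit vectors of size $n$ each, and let $\ell \geq 1$, $p \in \{0,1\}$, and $q \geq 0$ be integers. Then the unweighted, undirected graph $G := G_{L,R,\ell,p,q}$ has $O(nd\ell + dq)$ vertices and $O(nd\ell+dq)$ edges, and its diameter $D$ has the following property: if $\langle L, R\rangle$ contains an orthogonal pair, then $D = 6\ell - 3p + q$, and if $\langle L,R\rangle$ contains no orthogonal pair, then $D = 4\ell - 2p + q$.
   Context: Bit vectors $l, r\in\{0,1\}^d$ are orthogonal if for every $1\le k\le d$, $l[k]=0$ or $r[k]=0$. The instance $\langle L,R\rangle$ contains an orthogonal pair if some $l_i\in L$ and $r_j\in R$ are orthogonal. Definition of $G_{L,R,\ell,p,q}$ (unweighted, undirected). The graph has the following exterior vertices: $u_1^L,\dots,u_n^L$, $u_1^R,\dots,u_n^R$, $v_1^L,\dots,v_n^L$, $v_1^R,\dots,v_n^R$, $w_1^L,\dots,w_d^L$, $w_1^R,\dots,w_d^R$, $x^L$, $x^R$, $y^L$, $y^R$. These are connected by the following paths, where $\pi(a,b)$ denotes the path added between $a$ and $b$, its length is its number of edges, each path introduces its own separate set of interior vertices, and a path of length $0$ between $a$ and $b$ means that $a$ and $b$ are identified: (1) for every $1\le i\le n$, paths $\pi(u_i^L,v_i^L)$ and $\pi(u_i^R,v_i^R)$, each of length $\ell-p$; (2) for every $1\le i\le n$,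 paths $\pi(v_i^L,x^L)$ and $\pi(v_i^R,x^R)$, each of length $\ell$; (3) for every $1\le i\le n$ and $1\le k\le d$ with $l_i[k]=1$, a path $\pi(v_i^L,w_k^L)$ of length $\ell$; (4) for every $1\le i\le n$ and $1\le k\le d$ with $r_i[k]=1$, a path $\pi(v_i^R,w_k^R)$ of length $\ell$; (5) for every $1\le k\le d$, paths $\pi(y^L,w_k^L)$ and $\pi(y^R,w_k^R)$, each of length $\ell$; (6) for every $1\le k\le d$, a path $\pi(w_k^L,w_k^R)$ of length $q$ (so $w_k^L=w_k^R$ if $q=0$); (7) paths $\pi(x^L,y^L)$ and $\pi(x^R,y^R)$, each of length $\ell-p$; (8) a path $\pi(y^L,y^R)$ of length $p+q$ (so $y^L=y^R$ if $p+q=0$). In particular, if $\ell=1$ and $p=1$, then $x^L=y^L$, $x^R=y^R$, $u_i^L=v_i^L$ and $u_i^R=v_i^R$ for all $i$. The constants hidden in $O(\cdot)$ are absolute. *)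

(* Defs.v *)
From HB Require Import structures.
From mathcomp Require Import all_boot.

Set Implicit Arguments.
Unset Strict Implicit.
Unset Printing Implicit Defensive.

(** * Finite simple graphs *)

Record sgraph := SGraph {
  vertex :> finType;
  adj : rel vertex;
  adj_sym : symmetric adj;
  adj_irrefl : irreflexive adj
}.

Definition edges (G : sgraph) : {set {set G}} :=
  [set [set e.1; e.2] | e : G * G & adj e.1 e.2].

Definition has_walk (G : sgraph) (x y : G) (k : nat) : bool :=
  [exists s : k.-tuple G, path (@adj G) x s && (last x s == y)].

(* A shortest path has fewer than #|G| edges; if y cannot be reached from x the
   search fails and the value is #|G|, but then [diameter] below is [None]. *)
Definition distance (G : sgraph) (x y : G) : nat :=
  find (has_walk x y) (iota 0 #|G|).

(* [None] stands for an infinite diameter. *)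
Definition diameter (G : sgraph) : option nat :=
  if [forall x : G, forall y : G, connect (@adj G) x y]
  then Some (\max_(x : G) \max_(y : G) distance x y) else None.

(** * The graph obtained by joining prescribed points by paths *)

(* Every e : pidx asks for a path with plen e edges between psrc e and ptgt e. *)
Record path_system := PathSystem {
  ext : finType;
  pidx : finType;
  psrc : pidx -> ext;
  ptgt : pidx -> ext;
  plen : pidx -> nat
}.

(* Exterior vertices before identification, and for each path e its own
   (plen e).-1 interior vertices. *)
Definition prevertex (S : path_system) : finType :=
  (ext S + {e : pidx S & 'I_(plen e).-1})%type.

(* The point at distance i from psrc e on the path e; the interior vertex
   numbered j sits at position j.+1. *)
Definition ppoint (S : path_system) (e : pidx S) (i : nat) : prevertex S :=
  if i is j.+1 then
    if (insub j : option 'I_(plen e).-1) is Some o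
    then inr (existT (fun e : pidx S => 'I_(plen e).-1) e o)
    else inl (ptgt e)
  else inl (psrc e).

Definition preadj (S : path_system) : rel (prevertex S) := fun a b =>
  [exists e : pidx S, exists i : 'I_(plen e),
     ((ppoint e i == a) && (ppoint e i.+1 == b))
  || ((ppoint e i == b) && (ppoint e i.+1 == a))].

(* The two ends of a path of length 0. *)
Definition glue (S : path_system) : rel (prevertex S) := fun a b =>
  [exists e : pidx S, (plen e == 0) &&
    (((inl (psrc e) == a) && (inl (ptgt e) == b))
  || ((inl (psrc e) == b) && (inl (ptgt e) == a)))].

Lemma glue_sym (S : path_system) : symmetric (@glue S).
Proof.
by move=> a b; apply: eq_existsb => e; rewrite orbC.
Qed.

Lemma glued_equivalence (S : path_system) :
  equivalence_rel (connect (@glue S)).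
Proof.
by apply/equivalence_relP; split=> [x|x y xy];
  [exact: connect0 | apply: same_connect => //; apply: sym_connect_sym;
   exact: glue_sym].
Qed.

(* Gluing may chain, so a vertex is a class of the generated equivalence. *)
Definition pvertex (S : path_system) : finType :=
  {A : {set prevertex S} |
     A \in equivalence_partition (connect (@glue S)) [set: prevertex S]}.

Definition padj (S : path_system) : rel (pvertex S) := fun A B =>
  (A != B) &&
  [exists a in val A, exists b in val B, preadj a b].

Lemma preadj_sym (S : path_system) : symmetric (@preadj S).
Proof.
by move=> a b; apply: eq_existsb => e; apply: eq_existsb => i; rewrite orbC.
Qed.

Lemma padj_sym (S : path_system) : symmetric (@padj S).
Proof.
move=> A B; rewrite /padj eq_sym; congr (_ && _).
by apply/exists_inP/exists_inP => -[a aA /exists_inP[b bB ab]];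
  exists b => //; apply/exists_inP; exists a => //; rewrite preadj_sym.
Qed.

Lemma padj_irrefl (S : path_system) : irreflexive (@padj S).
Proof. by move=> A; rewrite /padj eqxx. Qed.

Definition path_graph (S : path_system) : sgraph :=
  SGraph (@padj_sym S) (@padj_irrefl S).

(** * Orthogonal vectors *)

Definition bitvec (d : nat) : finType := {ffun 'I_d -> bool}.

Definition orthogonal (d : nat) (a b : bitvec d) : bool :=
  [forall k, (a k == false) || (b k == false)].

Definition has_orthogonal_pair (n d : nat) (l r : 'I_n -> bitvec d) : bool :=
  [exists i, exists j, orthogonal (l i) (r j)].

(** * The graph G_{L,R,ell,p,q} *)

(* The superscript L is [false], the superscript R is [true]. *)
Definition side : finType := bool.
Definition sideL : side := false.
Definition sideR : side := true.

Inductive ov_ext (n d : nat) :=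
  | Uext of side & 'I_n
  | Vext of side & 'I_n
  | Wext of side & 'I_d
  | Xext of side
  | Yext of side.
Arguments Uext {n d}.
Arguments Vext {n d}.
Arguments Wext {n d}.
Arguments Xext {n d}.
Arguments Yext {n d}.

Definition ov_ext_code (n d : nat) (x : ov_ext n d) :
    side * 'I_n + side * 'I_n + side * 'I_d + side + side :=
  match x with
  | Uext s i => inl (inl (inl (inl (s, i))))
  | Vext s i => inl (inl (inl (inr (s, i))))
  | Wext s k => inl (inl (inr (s, k)))
  | Xext s => inl (inr s)
  | Yext s => inr s
  end.

Definition ov_ext_decode (n d : nat)
    (c : side * 'I_n + side * 'I_n + side * 'I_d + side + side) : ov_ext n d :=
  match c with
  | inl (inl (inl (inl (s, i)))) => Uext s i
  | inl (inl (inl (inr (s, i)))) => Vext s i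
  | inl (inl (inr (s, k))) => Wext s k
  | inl (inr s) => Xext s
  | inr s => Yext s
  end.

Lemma ov_ext_codeK (n d : nat) : cancel (@ov_ext_code n d) (@ov_ext_decode n d).
Proof. by case. Qed.

HB.instance Definition _ (n d : nat) :=
  Finite.copy (ov_ext n d) (can_type (@ov_ext_codeK n d)).

Inductive ov_label (n d : nat) :=
  | UVpath of side & 'I_n
  | VXpath of side & 'I_n
  | VWpath of side & 'I_n & 'I_d
  | YWpath of side & 'I_d
  | WWpath of 'I_d
  | XYpath of side
  | YYpath.
Arguments UVpath {n d}.
Arguments VXpath {n d}.
Arguments VWpath {n d}.
Arguments YWpath {n d}.
Arguments WWpath {n d}.
Arguments XYpath {n d}.
Arguments YYpath {n d}.

Definition ov_label_code (n d : nat) (e : ov_label n d) :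
    side * 'I_n + side * 'I_n + side * 'I_n * 'I_d + side * 'I_d + 'I_d
    + side + unit :=
  match e with
  | UVpath s i => inl (inl (inl (inl (inl (inl (s, i))))))
  | VXpath s i => inl (inl (inl (inl (inl (inr (s, i))))))
  | VWpath s i k => inl (inl (inl (inl (inr (s, i, k)))))
  | YWpath s k => inl (inl (inl (inr (s, k))))
  | WWpath k => inl (inl (inr k))
  | XYpath s => inl (inr s)
  | YYpath => inr tt
  end.

Definition ov_label_decode (n d : nat)
    (c : side * 'I_n + side * 'I_n + side * 'I_n * 'I_d + side * 'I_d + 'I_d
         + side + unit) : ov_label n d :=
  match c with
  | inl (inl (inl (inl (inl (inl (s, i)))))) => UVpath s i
  | inl (inl (inl (inl (inl (inr (s, i)))))) => VXpath s i
  | inl (inl (inl (inl (inr (s, i, k))))) => VWpath s i k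
  | inl (inl (inl (inr (s, k)))) => YWpath s k
  | inl (inl (inr k)) => WWpath k
  | inl (inr s) => XYpath s
  | inr _ => YYpath
  end.

Lemma ov_label_codeK (n d : nat) :
  cancel (@ov_label_code n d) (@ov_label_decode n d).
Proof. by case. Qed.

HB.instance Definition _ (n d : nat) :=
  Finite.copy (ov_label n d) (can_type (@ov_label_codeK n d)).

(* A path between v_i and w_k is added only when the bit k of the i-th vector of
   that side is 1; all other paths are always present. *)
Definition ov_present (n d : nat) (l r : 'I_n -> bitvec d)
    (e : ov_label n d) : bool :=
  if e is VWpath s i k then (if s == sideL then l i k else r i k) else true.

Definition ov_src (n d : nat) (e : ov_label n d) : ov_ext n d :=
  match e with
  | UVpath s i => Uext s i
  | VXpath s i => Vext s i
  | VWpath s i _ => Vext s i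
  | YWpath s _ => Yext s
  | WWpath k => Wext sideL k
  | XYpath s => Xext s
  | YYpath => Yext sideL
  end.

Definition ov_tgt (n d : nat) (e : ov_label n d) : ov_ext n d :=
  match e with
  | UVpath s i => Vext s i
  | VXpath s _ => Xext s
  | VWpath s _ k => Wext s k
  | YWpath s k => Wext s k
  | WWpath k => Wext sideR k
  | XYpath s => Yext s
  | YYpath => Yext sideR
  end.

Definition ov_len (n d ell p q : nat) (e : ov_label n d) : nat :=
  match e with
  | UVpath _ _ => ell - p
  | VXpath _ _ => ell
  | VWpath _ _ _ => ell
  | YWpath _ _ => ell
  | WWpath _ => q
  | XYpath _ => ell - p
  | YYpath => p + q
  end.

Definition ov_paths (n d : nat) (l r : 'I_n -> bitvec d) (ell p q : nat) :
    path_system :=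
  @PathSystem (ov_ext n d) {e : ov_label n d | ov_present l r e}
    (fun e => ov_src (val e)) (fun e => ov_tgt (val e))
    (fun e => ov_len ell p q (val e)).

Definition ov_graph (n d : nat) (l r : 'I_n -> bitvec d) (ell p q : nat) :
    sgraph :=
  path_graph (ov_paths l r ell p q).

(* Main.v *)
(* Upper bound: every vertex lies on some path pi(a,b) and leaves it through a
   or b, so the distance of two vertices is at most the minimum of four sums,
   each through a choice of one end per path. Distances of exterior vertices
   come from walks through the y's or along some pi(w_k^L, w_k^R); the one bound
   depending on the instance is that between v_i^L and v_j^R, which is 2 ell + q
   through a common 1-bit, and 4 ell - p + q in general. Averaging two of the
   four sums (and rounding down when p = 1) gives both bounds on the diameter.
   Lower bound: the distances from u_i^L form a function on the exterior vertices
   that changes along each path by at most its length, hence extends to a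
   1-Lipschitz function on the graph; at u_j^R it is 6 ell - 3 p + q or
   4 ell - 2 p + q, according to whether l_i and r_j are orthogonal. *)
Require Import Defs.
From mathcomp Require Import all_boot.
From mathcomp Require Import zify.

Set Implicit Arguments.
Unset Strict Implicit.
Unset Printing Implicit Defensive.

(** * Walks and the diameter *)

(** Bounding the length of some walk, rather than [distance], lets upper bounds be concatenated,
    reversed and weakened with no appeal to minimality. *)
Definition within (G : sgraph) (x y : G) (k : nat) : Prop :=
  exists s : seq G, [/\ path (@adj G) x s, last x s = y & size s <= k].

Lemma within_refl (G : sgraph) (x : G) : within x x 0.
Proof. by exists [::]. Qed.

Lemma within_le (G : sgraph) (x y : G) (j k : nat) :
  j <= k -> within x y j -> within x y k.
Proof. by move=> jk [s [xs sy sj]]; exists s; split=> //; apply: leq_trans jk. Qed.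

Lemma within_sym (G : sgraph) (x y : G) (k : nat) :
  within x y k -> within y x k.
Proof.
move=> [s [xs <- sk]]; exists (rev (belast x s)); split.
- by rewrite rev_path (eq_path (e' := @adj G)) // => a b; apply: adj_sym.
- by case: s {xs sk} => //= z s; rewrite rev_cons last_rcons.
- by rewrite size_rev size_belast.
Qed.

Lemma within_trans (G : sgraph) (x y z : G) (j k : nat) :
  within x y j -> within y z k -> within x z (j + k).
Proof.
move=> [s [xs sy sj]] [t [yt tz tk]]; exists (s ++ t); split.
- by rewrite cat_path xs sy.
- by rewrite last_cat sy.
- by rewrite size_cat leq_add.
Qed.

Lemma distance_leq (G : sgraph) (x y : G) (k : nat) :
  within x y k -> distance x y <= k.
Proof.
move=> [s [xs sy sk]]; apply: leq_trans sk; rewrite leqNgt; apply/negP => lt.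
(* [find] never exceeds the length of the searched list, so [size s] is among the lengths tried. *)
have ltG : size s < #|G|.
  by apply: leq_trans lt _; rewrite -[leqRHS](size_iota 0) find_size.
have := before_find 0 lt; rewrite nth_iota // add0n => /existsP[].
by exists (in_tuple s); rewrite xs sy eqxx.
Qed.

(** A walk shortened to a simple path has fewer than #|G| edges, so the search succeeds. *)
Lemma distance_walk (G : sgraph) (x y : G) :
  connect (@adj G) x y -> has_walk x y (distance x y).
Proof.
move=> /connectP[s xs ->]; case/shortenP: xs => t xt Ut _.
have ltG : size t < #|G| by have := max_card (mem (x :: t)); rewrite (card_uniqP Ut).
have hasw : has (has_walk x (last x t)) (iota 0 #|G|).
  apply/hasP; exists (size t); first by rewrite mem_iota.
  by apply/existsP; exists (in_tuple t); rewrite xt eqxx.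
have := nth_find 0 hasw; rewrite nth_iota ?add0n //.
by move: hasw; rewrite has_find size_iota.
Qed.

(** Along a walk f grows by at most 1 per edge, so any walk from a to b has at least D edges. *)
Lemma diameter_eq (G : sgraph) (D : nat) (a b : G) (f : G -> nat) :
  (forall x y : G, within x y D) ->
  (forall x y : G, adj x y -> f y <= (f x).+1) ->
  f a + D <= f b ->
  diameter G = Some D.
Proof.
move=> allD lipf fab; rewrite /diameter ifT; last first.
  apply/forallP=> x; apply/forallP=> y; apply/connectP.
  by have [s [xs sy _]] := allD x y; exists s.
congr Some; apply/eqP; rewrite eqn_leq; apply/andP; split.
  by apply/bigmax_leqP=> x _; apply/bigmax_leqP=> y _; apply/distance_leq/allD.
apply: (leq_trans _ (leq_bigmax a)); apply: (leq_trans _ (leq_bigmax b)).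
have /distance_walk/existsP[t /andP[pt /eqP lt]] : connect (@adj G) a b.
  by apply/connectP; have [s [xs sy _]] := allD a b; exists s.
have lipw (s : seq G) (x : G) : path (@adj G) x s -> f (last x s) <= f x + size s.
  elim: s x => [|y s IHs] x /=; first by rewrite addn0.
  move=> /andP[xy ys]; have := IHs y ys; have := lipf x y xy; lia.
by have := lipw t a pt; rewrite lt size_tuple; lia.
Qed.

(** * Graphs obtained by gluing paths *)

Definition pclass (S : path_system) (a : prevertex S) : path_graph S :=
  exist _ [set b in [set: prevertex S] | connect (@glue S) a b]
    (imset_f _ (in_setT a)).

Lemma mem_pclass (S : path_system) (a b : prevertex S) :
  (b \in val (pclass a)) = connect (@glue S) a b.
Proof. by rewrite !inE. Qed.

Lemma pclass_surj (S : path_system) (A : path_graph S) : exists a, A = pclass a.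
Proof.
by have /imsetP[a _ Aa] := valP A; exists a; apply: val_inj.
Qed.

Lemma pclass_eq (S : path_system) (a b : prevertex S) :
  connect (@glue S) a b -> pclass a = pclass b.
Proof.
move=> ab; apply/val_inj/setP=> c; rewrite !mem_pclass.
by apply: same_connect ab _; apply/sym_connect_sym/glue_sym.
Qed.

(** Gluing may merge the two ends of a step, and [padj] has no loops; hence length at most 1 rather
    than exactly 1. *)
Lemma preadj_within (S : path_system) (a b : prevertex S) :
  preadj a b -> within (pclass a) (pclass b) 1.
Proof.
move=> ab; have [->|neq] := eqVneq (pclass a) (pclass b).
  exact: within_le (leq0n _) (within_refl _).
exists [:: pclass b]; split=> //=; rewrite andbT /adj /= /padj neq /=.
apply/exists_inP; exists a; first by rewrite mem_pclass.
by apply/exists_inP; exists b; first by rewrite mem_pclass.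
Qed.

Definition path_point (S : path_system) (e : pidx S) (i : nat) : path_graph S :=
  pclass (ppoint e i).

Definition ext_point (S : path_system) (x : ext S) : path_graph S :=
  pclass (inl x).

(** On a path of length 0, position 0 is the source, which is glued to the target; on a longer path,
    [insub] fails just past the last interior vertex. *)
Lemma path_point_len (S : path_system) (e : pidx S) :
  path_point e (plen e) = ext_point (ptgt e).
Proof.
rewrite /path_point; case len: (plen e) => [|m] /=.
  apply/pclass_eq/connect1/existsP; exists e.
  by rewrite len !eqxx.
by rewrite insubN // len /= ltnn.
Qed.

Lemma path_pointS (S : path_system) (e : pidx S) (i : nat) :
  i < plen e -> within (path_point e i) (path_point e i.+1) 1.
Proof.
move=> ilt; apply: preadj_within; apply/existsP; exists e.
by apply/existsP; exists (Ordinal ilt); rewrite !eqxx.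
Qed.

Lemma path_pointD (S : path_system) (e : pidx S) (i k : nat) :
  i + k <= plen e -> within (path_point e i) (path_point e (i + k)) k.
Proof.
elim: k => [|k IHk]; first by rewrite addn0 => _; apply: within_refl.
rewrite addnS -[k.+1]addn1 => ik; apply: within_trans (IHk (ltnW ik)) _.
exact: path_pointS.
Qed.

Lemma within_src (S : path_system) (e : pidx S) (i : nat) :
  i <= plen e -> within (path_point e i) (ext_point (psrc e)) i.
Proof. by move=> ile; apply: within_sym; exact: (@path_pointD S e 0 i ile). Qed.

Lemma within_tgt (S : path_system) (e : pidx S) (i : nat) :
  i <= plen e -> within (path_point e i) (ext_point (ptgt e)) (plen e - i).
Proof.
move=> ile; have := @path_pointD S e i (plen e - i).
by rewrite subnKC // path_point_len; apply.
Qed.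

Lemma within_ends (S : path_system) (e : pidx S) :
  within (ext_point (psrc e)) (ext_point (ptgt e)) (plen e).
Proof. by have := within_tgt (leq0n (plen e)); rewrite subn0. Qed.

(** The hypothesis excludes isolated exterior vertices, which would lie on no path. *)
Lemma path_point_surj (S : path_system) (A : path_graph S) :
  (forall x : ext S, exists e : pidx S, x = psrc e \/ x = ptgt e) ->
  exists e : pidx S, exists2 i, i <= plen e & A = path_point e i.
Proof.
move=> ends; have [[x|[e o]] ->] := pclass_surj A.
  have [e [->|->]] := ends x; first by exists e, 0.
  by exists e, (plen e); rewrite ?path_point_len.
exists e, o.+1; first by have := ltn_ord o; lia.
by rewrite /path_point /= valK.
Qed.

(** * Potentials *)

(* The largest extension of phi that changes by at most 1 along each edge of a
   path. *)
Definition prepotential (S : path_system) (phi : ext S -> nat) (a : prevertex S) :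
    nat :=
  match a with
  | inl x => phi x
  | inr (existT e o) =>
      minn (phi (psrc e) + o.+1) (phi (ptgt e) + (plen e - o.+1))
  end.

Definition admissible (S : path_system) (phi : ext S -> nat) : Prop :=
  forall e : pidx S, phi (psrc e) <= phi (ptgt e) + plen e /\
                     phi (ptgt e) <= phi (psrc e) + plen e.

(** Admissibility makes the minimum equal to [phi] at both ends, so one formula covers exterior and
    interior points. *)
Lemma prepotential_ppoint (S : path_system) (phi : ext S -> nat) (e : pidx S)
    (i : nat) :
  admissible phi -> i <= plen e ->
  prepotential phi (ppoint e i) =
    minn (phi (psrc e) + i) (phi (ptgt e) + (plen e - i)).
Proof.
move=> adm ile; have [st ts] := adm e.
case: i ile => [|i] ile /=; first by rewrite addn0 subn0; lia.
case: insubP => [o _ <- //|]; rewrite -leqNgt /= => le; lia.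
Qed.

(** On a path of length 0 the two inequalities of [admissible] force equal values at its ends. *)
Lemma prepotential_glue (S : path_system) (phi : ext S -> nat) (a b : prevertex S) :
  admissible phi -> connect (@glue S) a b -> prepotential phi a = prepotential phi b.
Proof.
move=> adm /connectP[s + ->]; elim: s a => //= c s IHs a /andP[ac cs].
rewrite -(IHs c cs); case/existsP: ac => e /andP[/eqP len].
have [st ts] := adm e.
by case/orP=> /andP[/eqP <- /eqP <-] /=; lia.
Qed.

Lemma prepotential_adj (S : path_system) (phi : ext S -> nat) (a b : prevertex S) :
  admissible phi -> preadj a b -> prepotential phi b <= (prepotential phi a).+1.
Proof.
move=> adm /existsP[e /existsP[i]]; have lti := ltn_ord i.
by case/orP=> /andP[/eqP <- /eqP <-]; rewrite !prepotential_ppoint //; lia.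
Qed.

(** Classes are nonempty, so the default 0 is never taken; for admissible [phi] the picked
    representative does not matter. *)
Definition potential (S : path_system) (phi : ext S -> nat)
    (A : path_graph S) : nat :=
  if [pick a in val A] is Some a then prepotential phi a else 0.

Lemma potential_pclass (S : path_system) (phi : ext S -> nat) (a : prevertex S) :
  admissible phi -> potential phi (pclass a) = prepotential phi a.
Proof.
move=> adm; rewrite /potential; case: pickP => [b|/(_ a)];
  rewrite mem_pclass ?connect0 //.
by move/(prepotential_glue adm).
Qed.

Lemma adj_pclass (S : path_system) (A B : path_graph S) :
  adj A B -> exists a b, [/\ A = pclass a, B = pclass b & preadj a b].
Proof.
have [[a ->] [b ->]] := (pclass_surj A, pclass_surj B).
case/andP=> _ /exists_inP[a' + /exists_inP[b' + ab]]; rewrite !mem_pclass.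
by move=> /pclass_eq-> /pclass_eq->; exists a', b'.
Qed.

Lemma potential_adj (S : path_system) (phi : ext S -> nat) (A B : path_graph S) :
  admissible phi -> adj A B -> potential phi B <= (potential phi A).+1.
Proof.
by move=> adm /adj_pclass[a [b [-> -> ab]]];
  rewrite !potential_pclass // prepotential_adj.
Qed.

(** * Counting vertices and edges *)

Lemma card_tagged_ord (I : finType) (m : I -> nat) :
  #|{: {e : I & 'I_(m e)}}| = \sum_e m e.
Proof.
by rewrite card_tagged sumnE big_map big_enum;
  apply: eq_bigr => e _; apply: card_ord.
Qed.

Lemma card_path_graph (S : path_system) :
  #|path_graph S| <= #|ext S| + \sum_(e : pidx S) plen e.
Proof.
have -> : #|path_graph S| = #|[set pclass a | a : prevertex S]|.
  rewrite -cardsT; apply: eq_card => A; rewrite inE.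
  by have [a ->] := pclass_surj A; rewrite imset_f.
apply: leq_trans (leq_imset_card _ _) _.
rewrite card_sum card_tagged_ord leq_add2l.
by apply: leq_sum => e _; apply: leq_pred.
Qed.

(** Every edge comes from a unit step of some path, and a path e has [plen e] steps; gluing can only
    merge them. *)
Lemma card_edges_path_graph (S : path_system) :
  #|edges (path_graph S)| <= \sum_(e : pidx S) plen e.
Proof.
rewrite -card_tagged_ord.
pose edge (u : {e : pidx S & 'I_(plen e)}) : {set path_graph S} :=
  [set path_point (tag u) (tagged u); path_point (tag u) (tagged u).+1].
apply: leq_trans (_ : #|[set edge u | u in predT]| <= _); last exact: leq_imset_card.
apply/subset_leq_card/subsetP=> E /imsetP[[A B]]; rewrite inE /=.
move=> /adj_pclass[a [b [-> -> /existsP[e /existsP[i ab]]]]] ->.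
apply/imsetP; exists (existT _ e i) => //; rewrite /edge /path_point /=.
by case/orP: ab => /andP[/eqP <- /eqP <-] //; rewrite setUC.
Qed.

(** * Upper bounds on the distances in G_{L,R,ell,p,q} *)

Definition ov_point (n d : nat) (l r : 'I_n -> bitvec d) (ell p q : nat)
    (a : ov_ext n d) : ov_graph l r ell p q :=
  @ext_point (ov_paths l r ell p q) a.

Definition ext_side (n d : nat) (a : ov_ext n d) : side :=
  match a with
  | Uext s _ | Vext s _ | Wext s _ | Xext s | Yext s => s
  end.

Definition cross (s t : side) (m : nat) : nat := if s == t then 0 else m.

(** Length of the walk to the y of the same side along u, v, x, y, or directly from w. *)
Definition ydist (n d ell p : nat) (a : ov_ext n d) : nat :=
  match a with
  | Uext _ _ => 3 * ell - 2 * p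
  | Vext _ _ => 2 * ell - p
  | Wext _ _ => ell
  | Xext _ => ell - p
  | Yext _ => 0
  end.

(** The only path at u leads to v, so bounds for u are those for v plus ell - p. *)
Definition anchor (n d : nat) (a : ov_ext n d) : ov_ext n d :=
  if a is Uext s i then Vext s i else a.

Definition anchor_dist (n d ell p : nat) (a : ov_ext n d) : nat :=
  if a is Uext _ _ then ell - p else 0.

(* Walks go through the vertices y, except that to or from a w_k sides are
   changed along pi(w_k^L, w_k^R), that v's of the same side are joined through
   x, and that c bounds the distance of v's of different sides. *)
Definition anchor_bound (n d ell p q c : nat) (a b : ov_ext n d) : nat :=
  let viaw := ydist ell p a + ydist ell p b + cross (ext_side a) (ext_side b) q in
  let viay :=
    ydist ell p a + ydist ell p b + cross (ext_side a) (ext_side b) (p + q) in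
  match a, b with
  | Vext s _, Vext t _ => if s == t then 2 * ell else c
  | Vext s _, Xext t | Xext t, Vext s _ => if s == t then ell else viay
  | Wext _ _, _ | _, Wext _ _ => viaw
  | _, _ => viay
  end.

Definition ov_bound (n d ell p q c : nat) (a b : ov_ext n d) : nat :=
  anchor_dist ell p a + anchor_bound ell p q c (anchor a) (anchor b)
  + anchor_dist ell p b.

Lemma within_label (n d : nat) (l r : 'I_n -> bitvec d) (ell p q : nat)
    (e : ov_label n d) :
  ov_present l r e ->
  within (ov_point l r ell p q (ov_src e)) (ov_point l r ell p q (ov_tgt e))
    (ov_len ell p q e).
Proof.
by move=> he; apply: (@within_ends (ov_paths l r ell p q) (exist _ e he)).
Qed.

Lemma within_yy (n d : nat) (l r : 'I_n -> bitvec d) (ell p q : nat)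
    (s t : side) :
  within (ov_point l r ell p q (Yext s)) (ov_point l r ell p q (Yext t))
    (cross s t (p + q)).
Proof.
have LR := @within_label n d l r ell p q YYpath isT.
by case: s t => [] []; rewrite /cross /=; [apply: within_refl | apply: within_sym | |
  apply: within_refl].
Qed.

Lemma within_ww (n d : nat) (l r : 'I_n -> bitvec d) (ell p q : nat)
    (s t : side) (k : 'I_d) :
  within (ov_point l r ell p q (Wext s k)) (ov_point l r ell p q (Wext t k))
    (cross s t q).
Proof.
have LR := @within_label n d l r ell p q (WWpath k) isT.
by case: s t => [] []; rewrite /cross /=; [apply: within_refl | apply: within_sym | |
  apply: within_refl].
Qed.

Lemma within_y (n d : nat) (l r : 'I_n -> bitvec d) (ell p q : nat)
    (a : ov_ext n d) :
  p <= ell ->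
  within (ov_point l r ell p q a) (ov_point l r ell p q (Yext (ext_side a)))
    (ydist ell p a).
Proof.
move=> ple; have lab e := @within_label n d l r ell p q e.
have xy s := lab (XYpath s) isT.
have vy s i := within_trans (lab (VXpath s i) isT) (xy s).
case: a => s => [i|i|k||] /=.
- apply: within_le (within_trans (lab (UVpath s i) isT) (vy s i)) => /=; lia.
- by apply: within_le (vy s i) => /=; lia.
- exact/within_sym/(lab (YWpath s k)).
- exact: xy.
- exact: within_refl.
Qed.

Lemma within_viay (n d : nat) (l r : 'I_n -> bitvec d) (ell p q : nat)
    (a b : ov_ext n d) :
  p <= ell ->
  within (ov_point l r ell p q a) (ov_point l r ell p q b)
    (ydist ell p a + ydist ell p b + cross (ext_side a) (ext_side b) (p + q)).
Proof.
move=> ple.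
have ab := within_trans (within_y l r q a ple)
  (within_yy l r ell p q (ext_side a) (ext_side b)).
by apply: within_le (within_trans ab (within_sym (within_y l r q b ple))); lia.
Qed.

Lemma within_viaw (n d : nat) (l r : 'I_n -> bitvec d) (ell p q : nat)
    (a : ov_ext n d) (t : side) (k : 'I_d) :
  p <= ell ->
  within (ov_point l r ell p q a) (ov_point l r ell p q (Wext t k))
    (ydist ell p a + ell + cross (ext_side a) t q).
Proof.
move=> ple.
have yw := within_label ell p q (isT : ov_present l r (YWpath (ext_side a) k)).
have aw := within_trans (within_y l r q a ple) yw.
by apply: within_le (within_trans aw (within_ww l r ell p q (ext_side a) t k)).
Qed.

Lemma cross_sym (s t : side) (m : nat) : cross s t m = cross t s m.
Proof. by rewrite /cross eq_sym. Qed.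

Lemma within_bound (n d : nat) (l r : 'I_n -> bitvec d) (ell p q c : nat)
    (a b : ov_ext n d) :
  p <= ell ->
  (forall i j, within (ov_point l r ell p q (Vext sideL i))
                      (ov_point l r ell p q (Vext sideR j)) c) ->
  within (ov_point l r ell p q a) (ov_point l r ell p q b)
    (ov_bound ell p q c a b).
Proof.
move=> ple vv; have lab e := @within_label n d l r ell p q e.
have viay a' b' := within_viay l r q a' b' ple.
have viaw a' t k := within_viaw l r q a' t k ple.
have wvia a' t k : within (ov_point l r ell p q (Wext t k))
    (ov_point l r ell p q a') (ell + ydist ell p a' + cross t (ext_side a') q).
  by apply: within_le (within_sym (viaw a' t k)); rewrite cross_sym; lia.
have to_anchor a' : within (ov_point l r ell p q a')
    (ov_point l r ell p q (anchor a')) (anchor_dist ell p a').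
  case: a' => *; try exact: within_refl.
  exact: (lab (UVpath _ _)).
suff ab: within (ov_point l r ell p q (anchor a)) (ov_point l r ell p q (anchor b))
    (anchor_bound ell p q c (anchor a) (anchor b)).
  exact: within_trans (within_trans (to_anchor a) ab) (within_sym (to_anchor b)).
(* An anchor is never a u, which removes those cases from the analysis below. *)
have {to_anchor}: (if anchor a is Uext _ _ then false else true) by case: a.
have: (if anchor b is Uext _ _ then false else true) by case: b.
have vx s i := lab (VXpath s i) isT.
move: (anchor a) (anchor b) => {}a {}b.
case: a => [//|s i|s k|s|s]; case: b => [//|t j|t m|t|t] _ _; rewrite /anchor_bound;
  try solve [exact: viay | exact: viaw | exact: wvia].
- case: eqVneq => [<-|].
    by apply: within_le (within_trans (vx s i) (within_sym (vx s j))) => /=; lia.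
  by case: s t => [] [] // _; apply: within_sym; apply: vv.
- by case: eqVneq => [<-|_]; [exact: vx | exact: viay].
- by case: eqVneq => [->|_]; [exact/within_sym/vx | exact: viay].
Qed.

Lemma within_vv_cross (n d : nat) (l r : 'I_n -> bitvec d) (ell p q : nat)
    (i j : 'I_n) :
  ~~ orthogonal (l i) (r j) ->
  within (ov_point l r ell p q (Vext sideL i))
         (ov_point l r ell p q (Vext sideR j)) (2 * ell + q).
Proof.
move=> /forallPn[k]; rewrite negb_or !eqbF_neg !negbK => /andP[lk rk].
have lab e := @within_label n d l r ell p q e.
have iw := lab (VWpath sideL i k) lk; have jw := lab (VWpath sideR j k) rk.
have ij := within_trans (within_trans iw (lab (WWpath k) isT)) (within_sym jw).
by apply: within_le ij => /=; lia.
Qed.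

(** The bounds depend only on the kinds and sides of the ends, not on their indices, so destructing
    labels and sides leaves finitely many linear problems over the integers. *)
Lemma ov_bound_ends (n d ell p q c D : nat) (e f : ov_label n d) (i j : nat) :
  p <= 1 -> 1 <= ell ->
  (c = 2 * ell + q /\ D = 4 * ell - 2 * p + q) \/
  (c = 4 * ell - p + q /\ D = 6 * ell - 3 * p + q) ->
  i <= ov_len ell p q e -> j <= ov_len ell p q f ->
  let bound := @ov_bound n d ell p q c in
  [|| i + bound (ov_src e) (ov_src f) + j <= D,
      i + bound (ov_src e) (ov_tgt f) + (ov_len ell p q f - j) <= D,
      (ov_len ell p q e - i) + bound (ov_tgt e) (ov_src f) + j <= D
    | (ov_len ell p q e - i) + bound (ov_tgt e) (ov_tgt f)
      + (ov_len ell p q f - j) <= D].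
Proof.
move=> p1 ell1 cD; rewrite /ov_bound /anchor_bound /cross.
have [p0|p0] : p = 0 \/ p = 1 by lia.
all: subst p; case: cD => [[-> ->]|[-> ->]].
all: case: e => [s ?|s ?|s ? ?|s ?|?|s|]; try case: s.
all: case: f => [t ?|t ?|t ? ?|t ?|?|t|]; try case: t.
all: rewrite /=; lia.
Qed.

Lemma ov_ext_ends (n d : nat) (l r : 'I_n -> bitvec d) (ell p q : nat)
    (x : ext (ov_paths l r ell p q)) :
  0 < d -> exists e, x = psrc e \/ x = ptgt e.
Proof.
move=> d0; pose mk e he : pidx (ov_paths l r ell p q) := exist _ e he.
case: x => s => [i|i|k||].
- by exists (@mk (UVpath s i) isT); left.
- by exists (@mk (UVpath s i) isT); right.
- by exists (@mk (YWpath s k) isT); right.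
- by exists (@mk (XYpath s) isT); left.
- by exists (@mk (XYpath s) isT); right.
Qed.

Lemma ov_within (n d : nat) (l r : 'I_n -> bitvec d) (ell p q c D : nat)
    (A B : ov_graph l r ell p q) :
  0 < d -> p <= 1 -> 1 <= ell ->
  (c = 2 * ell + q /\ D = 4 * ell - 2 * p + q) \/
  (c = 4 * ell - p + q /\ D = 6 * ell - 3 * p + q) ->
  (forall i j, within (ov_point l r ell p q (Vext sideL i))
                      (ov_point l r ell p q (Vext sideR j)) c) ->
  within A B D.
Proof.
move=> d0 p1 ell1 cD vv.
have ends x := @ov_ext_ends n d l r ell p q x d0.
have [e [i ile ->]] := path_point_surj A ends.
have [f [j jle ->]] := path_point_surj B ends.
have bnd a b := within_bound a b (leq_trans p1 ell1) vv.
have [es et] := (within_src ile, within_tgt ile).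
have [fs ft] := (within_sym (within_src jle), within_sym (within_tgt jle)).
case/or4P: (ov_bound_ends p1 ell1 cD ile jle) => le; apply: within_le le _.
- exact: within_trans (within_trans es (bnd _ _)) fs.
- exact: within_trans (within_trans es (bnd _ _)) ft.
- exact: within_trans (within_trans et (bnd _ _)) fs.
- exact: within_trans (within_trans et (bnd _ _)) ft.
Qed.

(** * Lower bounds on the distances in G_{L,R,ell,p,q} *)

(* The distance from u_i^L. *)
Definition dist_from_u (n d : nat) (l r : 'I_n -> bitvec d) (ell p q : nat)
    (i : 'I_n) (a : ov_ext n d) : nat :=
  let distVR j :=
    if orthogonal (l i) (r j) then 5 * ell - 2 * p + q else 3 * ell - p + q in
  match a with
  | Uext s j => if s == sideR then distVR j + (ell - p)
                else if j == i then 0 else 4 * ell - 2 * p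
  | Vext s j => if s == sideR then distVR j
                else if j == i then ell - p else 3 * ell - p
  | Wext s k => (if l i k then 2 * ell - p else 4 * ell - 2 * p)
                + cross sideL s q
  | Xext s => if s == sideR then 4 * ell - 2 * p + q else 2 * ell - p
  | Yext s => if s == sideR then 3 * ell - p + q else 3 * ell - 2 * p
  end.

Lemma dist_from_u_admissible (n d : nat) (l r : 'I_n -> bitvec d) (ell p q : nat)
    (i : 'I_n) :
  p <= 1 -> 1 <= ell ->
  @admissible (ov_paths l r ell p q) (dist_from_u l r ell p q i).
Proof.
move=> p1 ell1 [e he] /=.
case: e he => [s j|s j|s j k|s k|k|s|] /= he; try case: s he => he /=.
all: rewrite ?/cross /=; try (repeat case: ifP => _; lia).
(* Path from v_j^R to w_k^R: if l_i and r_j are orthogonal, bit k of l_i is 0, so w_k^R has value 4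
   ell - 2 p + q, exactly ell below v_j^R. *)
- have rjk : r j k by [].
  case: ifP => [/forallP/(_ k)|_]; last by case: ifP => _; lia.
  by rewrite !eqbF_neg rjk orbF => /negPf->; lia.
(* Path from v_j^L to w_k^L: for j = i the bit is 1, so the values are ell - p and 2 ell - p. *)
- have: l j k by [].
  by case: eqVneq => [-> ->|_ _]; [|case: ifP => _]; lia.
Qed.

Lemma ov_diameter (n d : nat) (l r : 'I_n -> bitvec d) (ell p q c D : nat)
    (i j : 'I_n) :
  0 < d -> p <= 1 -> 1 <= ell ->
  (c = 2 * ell + q /\ D = 4 * ell - 2 * p + q) \/
  (c = 4 * ell - p + q /\ D = 6 * ell - 3 * p + q) ->
  (forall i j, within (ov_point l r ell p q (Vext sideL i))
                      (ov_point l r ell p q (Vext sideR j)) c) ->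
  D <= dist_from_u l r ell p q i (Uext sideR j) ->
  diameter (ov_graph l r ell p q) = Some D.
Proof.
move=> d0 p1 ell1 cD vv far.
have adm := @dist_from_u_admissible n d l r ell p q i p1 ell1.
apply: (@diameter_eq _ _ (ov_point l r ell p q (Uext sideL i))
  (ov_point l r ell p q (Uext sideR j))
  (@potential (ov_paths l r ell p q) (dist_from_u l r ell p q i))).
- by move=> A B; apply: ov_within cD vv.
- by move=> A B; apply: potential_adj.
(* The potential vanishes at u_i^L, so [far] is the required gap. *)
- by rewrite !potential_pclass //= eqxx.
Qed.

(** * The size of G_{L,R,ell,p,q} *)

Lemma card_ov_ext (n d : nat) : #|{: ov_ext n d}| = 4 * n + 2 * d + 4.
Proof.
have /bij_eq_card-> : bijective (@ov_ext_code n d).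
  by exists (@ov_ext_decode n d); [exact: ov_ext_codeK | case=> [[[[[]|[]]|[]]|]|]].
by rewrite !(card_sum, card_prod, card_ord, card_bool); lia.
Qed.

(** Lets the size bounds sum over all labels, whether or not the bit vectors make the path
    present. *)
Lemma leq_sum_sub (I : finType) (P : pred I) (F : I -> nat) :
  \sum_(x : {x | P x}) F (val x) <= \sum_x F x.
Proof.
rewrite -(big_sub P F) [leqRHS](bigID (mem P)) /=.
exact: leq_addr.
Qed.

Lemma sum_ov_len (n d ell p q : nat) :
  \sum_(e : ov_label n d) ov_len ell p q e =
  2 * n * (ell - p) + 2 * n * ell + 2 * n * d * ell + 2 * d * ell + d * q
  + 2 * (ell - p) + (p + q).
Proof.
have cancel_code : cancel (@ov_label_decode n d) (@ov_label_code n d).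
  by case=> [[[[[[[]|[]]|[[]]]|[]]|]|]|[]].
(* Over the coding by a disjoint sum, the length is constant on each summand. *)
rewrite (reindex (@ov_label_decode n d)) /=; last first.
  exact/onW_bij/(Bijective cancel_code)/ov_label_codeK.
rewrite !big_sumType /=.
have sum_const (T : finType) (m : nat) (F : T -> nat) :
    (forall x, F x = m) -> \sum_x F x = #|T| * m.
  by move=> Fm; rewrite (eq_bigr _ (fun x _ => Fm x)) sum_nat_const.
rewrite (sum_const _ (ell - p)); last by case.
rewrite (sum_const _ ell); last by case.
rewrite (sum_const _ ell); last by case=> [[]].
rewrite (sum_const _ ell); last by case.
rewrite !sum_nat_const !card_prod !card_ord !card_bool card_unit; lia.
Qed.

(** The exterior vertices contribute at most 10 n d ell and the lengths at most 11 n d ell + 2 d q,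
    so 22 suffices. *)
Lemma ov_size (n d ell p q : nat) :
  1 <= n -> 1 <= d -> 1 <= ell -> p <= 1 ->
  4 * n + 2 * d + 4 + \sum_(e : ov_label n d) ov_len ell p q e
    <= 22 * (n * d * ell + d * q).
Proof.
move=> n1 d1 ell1 p1; rewrite sum_ov_len.
have n_le : n <= n * ell by rewrite leq_pmulr.
have d_le : d <= d * ell by rewrite leq_pmulr.
have ell_le : ell <= d * ell by rewrite leq_pmull.
have q_le : q <= d * q by rewrite leq_pmull.
have nell_le : n * ell <= n * d * ell by rewrite leq_mul2r leq_pmulr ?orbT.
have dell_le : d * ell <= n * d * ell by rewrite leq_mul2r leq_pmull ?orbT.
have nellp_le : n * (ell - p) <= n * ell by rewrite leq_mul2l leq_subr orbT.
lia.
Qed.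

(** * Size bounds and the two values of the diameter *)

Theorem theorem3p1 :
  exists C : nat,
  forall (n d : nat) (l r : 'I_n -> bitvec d) (ell p q : nat),
    1 <= n -> 1 <= d ->
    injective l -> injective r ->
    1 <= ell -> p \in [:: 0; 1] ->
    let G := ov_graph l r ell p q in
    [/\ #|G| <= C * (n * d * ell + d * q),
        #|edges G| <= C * (n * d * ell + d * q),
        has_orthogonal_pair l r ->
          diameter G = Some (6 * ell - 3 * p + q)
      & ~~ has_orthogonal_pair l r ->
          diameter G = Some (4 * ell - 2 * p + q)].
Proof.
exists 22 => n d l r ell p q n1 d1 _ _ ell1 p01 G.
have p1 : p <= 1 by move: p01; rewrite !inE => /orP[] /eqP->.
have size_le := ov_size q n1 d1 ell1 p1.
have len_le := leq_sum_sub (ov_present l r) (@ov_len n d ell p q).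
split.
- apply: leq_trans (card_path_graph _) (leq_trans _ size_le).
  by rewrite card_ov_ext leq_add2l.
- apply: leq_trans (card_edges_path_graph _) _.
  by apply: leq_trans len_le _; apply: leq_trans size_le; apply: leq_addl.
- move=> /existsP[i /existsP[j orth]].
  (* The walk from v^L to v^R through both y's has length 2 (2 ell - p) + (p + q). *)
  apply: (@ov_diameter _ _ _ _ _ _ _ (4 * ell - p + q) _ i j) => //.
  + by right.
  + move=> i' j'; have ple := leq_trans p1 ell1.
    apply: within_le (within_viay l r q (Vext sideL i') (Vext sideR j') ple).
    by rewrite /cross /=; lia.
  + by rewrite /= orth; lia.
- move=> /existsPn noorth.
  have nonorth i j : ~~ orthogonal (l i) (r j) by have /existsPn := noorth i; apply.
  (* No pair is orthogonal, so any two indices realise the lower bound; index 0 exists as n is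
     positive. *)
  apply: (@ov_diameter _ _ _ _ _ _ _ (2 * ell + q) _
    (Ordinal n1) (Ordinal n1)) => //.
  + by left.
  + by move=> i j; apply: within_vv_cross.
  + by rewrite /= (negPf (nonorth _ _)); lia.
Qed.
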